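(* For every $n\ge 1$ let $\widetilde{BMW}_n$ be the $R$-algebra defined in the context. (1) The natural surjective $R$-algebra morphism $H_n\to \mathcal{H}_n(b,c)$, $s_i\mapsto s_i$, factorizes through $\widetilde{BMW}_n$. (2) For every $n\ge 1$, denoting by $A_n$ the image of $\widetilde{BMW}_n$ in $\widetilde{BMW}_{n+1}$ under the natural morphism $s_i\mapsto s_i$, one has $$\widetilde{BMW}_{n+1}=A_n+A_n s_n A_n+A_n s_n^{-1}A_n .$$ (3) For every $n\ge 1$, $\widetilde{BMW}_n$ is a finitely generated $R$-module.
   Context: $R=\mathbb{Q}[a,b,c,(abc)^{-1}]$, $x=b+c$, $y=bc$. $B_n$ is the braid group on $n$ strands with Artin generators $s_1,\dots,s_{n-1}$. $H_n$ is the quotient of the group algebra $RB_n$ by the relations $(s_i-a)(s_i-b)(s_i-c)=0$, $1\le i\le n-1$. $\mathcal{H}_n(b,c)$ is the quotient of $RB_n$ by the relations $(s_i-b)(s_i-c)=0$. $\widetilde{BMW}_n$ is the quotient of $H_n$ by the two-sided ideal generated by the elements $$\mathcal{R}_i=-y\,s_is_{i+1}^{-1}s_i+y^2s_{i+1}^{-1}s_is_{i+1}^{-1}-s_is_{i+1}s_i-xy^2s_{i+1}^{-2}+x\,s_i^2+y^3s_{i+1}^{-1}s_i^{-1}s_{i+1}^{-1},\quad 1\le i\le n-2$$ (so $\widetilde{BMW}_n=H_n$ for $n\le 2$, and $\widetilde{BMW}_1=R$). *)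

(* Defs.v *)
From HB Require Import structures.
From mathcomp Require Import all_boot all_order all_algebra.
From mathcomp Require Import generic_quotient ring_quotient fraction.
From mathcomp Require Import finmap boolp.
From mathcomp Require mpoly.
From mathcomp Require Import monalg.
From mathcomp Require Import ring.

Set Implicit Arguments.
Unset Strict Implicit.
Unset Printing Implicit Defensive.

Import GRing.Theory.
Local Open Scope ring_scope.
Local Open Scope quotient_scope.

(* A word is a list of letters; [(i, false)] stands for the generator [i] and
   [(i, true)] for its inverse. *)
Definition word (I : choiceType) := seq (I * bool).

Section Presentation.
Variables (I : choiceType) (rels : word I -> word I -> Prop).

Definition letter_inv (x : I * bool) : I * bool := (x.1, ~~ x.2).
Definition word_inv (u : word I) : word I := rev (map letter_inv u).

Inductive word_cong : word I -> word I -> Prop :=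
| wc_refl u : word_cong u u
| wc_sym u v : word_cong u v -> word_cong v u
| wc_trans u v w : word_cong u v -> word_cong v w -> word_cong u w
| wc_cat u u' v v' :
    word_cong u u' -> word_cong v v' -> word_cong (u ++ v) (u' ++ v')
| wc_inv x : word_cong [:: x; letter_inv x] [::]
| wc_rel u v : rels u v -> word_cong u v.

Definition word_eqv : rel (word I) := fun u v => `[< word_cong u v >].

Lemma word_eqv_is_equiv : equiv_class_of word_eqv.
Proof.
split=> [u|u v|v u w].
- exact/asboolP/wc_refl.
- by apply/asboolP/asboolP => /wc_sym.
- by move=> /asboolP uv /asboolP vw; apply/asboolP/(wc_trans uv).
Qed.

Canonical word_eqv_equiv := EquivRelPack word_eqv_is_equiv.
Canonical word_eqv_encModRel := defaultEncModRel word_eqv.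

Definition presented := {eq_quot word_eqv}.
HB.instance Definition _ := Choice.on presented.
HB.instance Definition _ : EqQuotient (word I) word_eqv presented :=
  EqQuotient.on presented.

Definition pword (u : word I) : presented := \pi_presented u.

Lemma pword_eq u v : pword u = pword v <-> word_cong u v.
Proof.
rewrite /pword; split=> [/eqP|uv].
  by rewrite (@eqquotE _ _ presented) => /asboolP.
by apply/eqP; rewrite (@eqquotE _ _ presented); apply/asboolP.
Qed.

Lemma pwordP (g : presented) : exists u, g = pword u.
Proof. by exists (repr g); rewrite /pword reprK. Qed.

Lemma letter_invK : involutive letter_inv.
Proof. by case=> i b; rewrite /letter_inv negbK. Qed.

Lemma word_invK : involutive word_inv.
Proof.
by move=> u; rewrite /word_inv map_rev revK -map_comp map_id_in // => x _;
   rewrite /= letter_invK.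
Qed.

Lemma wc_word_inv u : word_cong (u ++ word_inv u) [::].
Proof.
elim: u => [|x u IH]; first exact: wc_refl.
have -> : (x :: u) ++ word_inv (x :: u) =
  [:: x] ++ ((u ++ word_inv u) ++ [:: letter_inv x]).
  by rewrite /word_inv /= rev_cons -cats1 -!catA.
apply: (wc_trans (wc_cat (wc_refl [:: x]) (wc_cat IH (wc_refl _)))) => /=.
exact: wc_inv.
Qed.

Lemma wc_inv_mono u v :
  word_cong u v -> word_cong (word_inv u) (word_inv v).
Proof.
move=> uv; have vV : word_cong (word_inv v ++ v) [::].
  by rewrite -{2}[v]word_invK; apply: wc_word_inv.
apply: (@wc_trans _ ((word_inv v ++ u) ++ word_inv u)).
  rewrite -{1}[word_inv u]cat0s; apply: wc_cat (wc_refl _); apply: wc_sym.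
  by apply: wc_trans vV; apply: wc_cat uv; apply: wc_refl.
rewrite -catA -{2}[word_inv v]cats0; apply: wc_cat (wc_refl _) _.
exact: wc_word_inv.
Qed.

Definition pone : presented := pword [::].
Definition pmul (g h : presented) : presented := pword (repr g ++ repr h).
Definition pinv (g : presented) : presented := pword (word_inv (repr g)).

Lemma repr_pword u : word_cong (repr (pword u)) u.
Proof. by apply/pword_eq; rewrite /pword reprK. Qed.

Lemma pmulE u v : pmul (pword u) (pword v) = pword (u ++ v).
Proof. by apply/pword_eq/wc_cat; apply: repr_pword. Qed.

Lemma pinvE u : pinv (pword u) = pword (word_inv u).
Proof. exact/pword_eq/wc_inv_mono/repr_pword. Qed.

Lemma pmulA : associative pmul.
Proof.
move=> g h k; have [u ->] := pwordP g; have [v ->] := pwordP h.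
by have [w ->] := pwordP k; rewrite !pmulE catA.
Qed.

Lemma pmul1 : left_id pone pmul.
Proof. by move=> g; have [u ->] := pwordP g; rewrite pmulE. Qed.

Lemma p1mul : right_id pone pmul.
Proof. by move=> g; have [u ->] := pwordP g; rewrite pmulE cats0. Qed.

Lemma pmulV : right_inverse pone pinv pmul.
Proof.
move=> g; have [u ->] := pwordP g; rewrite pinvE pmulE.
exact/pword_eq/wc_word_inv.
Qed.

Lemma pVmul : left_inverse pone pinv pmul.
Proof.
move=> g; have [u ->] := pwordP g; rewrite pinvE pmulE.
by apply/pword_eq; rewrite -{2}[u]word_invK; apply: wc_word_inv.
Qed.

HB.instance Definition _ := isGroup.Build presented
  pmulA pmul1 p1mul pVmul pmulV.

Definition pgen (i : I) : presented := pword [:: (i, false)].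

Lemma pwordM u v : (pword u * pword v)%g = pword (u ++ v).
Proof. exact: pmulE. Qed.

Lemma pwordV u : (pword u)^-1%g = pword (word_inv u).
Proof. exact: pinvE. Qed.

Section Eval.
Variables (A : pzRingType) (f : I * bool -> A).
Hypothesis fV : forall x, f x * f (letter_inv x) = 1.
Hypothesis fP :
  forall u v, rels u v -> \prod_(x <- u) f x = \prod_(x <- v) f x.

Lemma prod_word_cong u v :
  word_cong u v -> \prod_(x <- u) f x = \prod_(x <- v) f x.
Proof.
elim=> {u v} [//|u v _ ->|u v w _ -> _ ->|u u' v v' _ IHu _ IHv|x|] //.
- by rewrite !big_cat IHu IHv.
- by rewrite !big_cons big_nil mulr1 fV.
Qed.

Lemma prod_repr_word u :
  \prod_(x <- repr (pword u)) f x = \prod_(x <- u) f x.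
Proof. exact/prod_word_cong/repr_pword. Qed.

Lemma prod_reprM (g h : presented) :
  \prod_(x <- repr (g * h)%g) f x =
    (\prod_(x <- repr g) f x) * (\prod_(x <- repr h) f x).
Proof.
have [u ->] := pwordP g; have [v ->] := pwordP h.
by rewrite pwordM !prod_repr_word big_cat.
Qed.

Lemma prod_repr1 : \prod_(x <- repr (1%g : presented)) f x = 1.
Proof. by rewrite (prod_repr_word [::]) big_nil. Qed.
End Eval.

End Presentation.

Section GroupAlgebra.
Variables (R : comNzRingType) (G : groupType).

(* Finitely supported functions [G -> R]; the product of [{malg R[G]}] is not
   available here because a [monomType] has no nontrivial invertible element. *)
Definition galg := {malg R[G]}.
HB.instance Definition _ := GRing.Lmodule.on galg.

Implicit Types (x y z : galg) (g h : G).

Definition gelt g : galg := << (1 : R) *g g >>.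

Lemma gelt_span x : x = \sum_(g <- msupp x) x@_g *: gelt g.
Proof.
rewrite [LHS]monalgE; apply/eq_bigr => g _; apply/malgP => k.
by rewrite mcoeffZ !mcoeffU mulrnAr mulr1.
Qed.

Definition glin (V : lmodType R) (f : G -> V) x : V :=
  \sum_(g <- msupp x) x@_g *: f g.

Section Lin.
Variables (V : lmodType R) (f : G -> V).

Lemma glinEw (d : {fset G}) x :
  (msupp x `<=` d)%fset -> glin f x = \sum_(g <- d) x@_g *: f g.
Proof.
move=> le; rewrite /glin (big_fset_incl _ le) //= => g _ /mcoeff_outdom ->.
by rewrite scale0r.
Qed.

Lemma glin_is_linear : linear (glin f).
Proof.
move=> c x y; pose d := (msupp x `|` msupp y)%fset.
rewrite (@glinEw d x) ?fsubsetUl // (@glinEw d y) ?fsubsetUr //.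
rewrite (@glinEw d).
  rewrite scaler_sumr -big_split /=; apply/eq_bigr => g _.
  by rewrite mcoeffD mcoeffZ scalerDl scalerA.
apply: fsubset_trans (msuppD_le _ _) _; apply: fsetUSS => //.
exact: msuppZ_le.
Qed.
HB.instance Definition _ :=
  GRing.isLinear.Build R galg V *:%R (glin f) glin_is_linear.

Lemma glinE g : glin f (gelt g) = f g.
Proof.
by rewrite (glinEw msuppU_le) big_seq_fset1 mcoeffUU scale1r.
Qed.

Lemma glin_uniq (k : {linear galg -> V}) :
  (forall g, k (gelt g) = f g) -> k =1 glin f.
Proof.
move=> kE x; rewrite {1}[x]gelt_span linear_sum; apply/eq_bigr => g _.
by rewrite linearZ /= kE.
Qed.
End Lin.

Definition gmul x y : galg := glin (fun g => glin (fun h => gelt (g * h)%g) y) x.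

Lemma gmulE g h : gmul (gelt g) (gelt h) = gelt (g * h)%g.
Proof. by rewrite /gmul !glinE. Qed.

Definition gmulr y x := gmul x y.

Lemma gmul_linl y : linear (gmulr y).
Proof. exact: glin_is_linear. Qed.

Lemma gmul_linr x : linear (gmul x).
Proof.
move=> c y z; rewrite /gmul /glin scaler_sumr -big_split /=.
apply/eq_bigr => g _; rewrite -/(glin _ _) linearP scalerDr !scalerA.
by rewrite mulrC.
Qed.

HB.instance Definition _ y :=
  GRing.isLinear.Build R galg galg *:%R (gmulr y) (gmul_linl y).
HB.instance Definition _ x :=
  GRing.isLinear.Build R galg galg *:%R (gmul x) (gmul_linr x).

Lemma gmulDl : left_distributive gmul +%R.
Proof. by move=> x y z; apply: (linearD (gmulr z)). Qed.

Lemma gmulDr : right_distributive gmul +%R.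
Proof. by move=> x y z; apply: (linearD (gmul x)). Qed.

Lemma gmulZl c x y : gmul (c *: x) y = c *: gmul x y.
Proof. exact: (linearZ_LR (gmulr y)). Qed.

Lemma gmulZr c x y : gmul x (c *: y) = c *: gmul x y.
Proof. exact: (linearZ_LR (gmul x)). Qed.

Lemma gmul_suml (J : Type) (r : seq J) (F : J -> galg) y :
  gmul (\sum_(j <- r) F j) y = \sum_(j <- r) gmul (F j) y.
Proof. exact: (linear_sum (gmulr y)). Qed.

Lemma gmul_sumr (J : Type) (r : seq J) (F : J -> galg) x :
  gmul x (\sum_(j <- r) F j) = \sum_(j <- r) gmul x (F j).
Proof. exact: (linear_sum (gmul x)). Qed.

Lemma gmulA : associative gmul.
Proof.
move=> x y z; rewrite [x]gelt_span (gmul_suml _ _ (gmul y z)).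
rewrite (gmul_suml _ _ y) (gmul_suml _ _ z); apply/eq_bigr => g _.
rewrite (gmulZl _ _ (gmul y z)) (gmulZl _ _ y) (gmulZl _ _ z).
congr (_ *: _); rewrite [y]gelt_span (gmul_suml _ _ z).
rewrite !(gmul_sumr _ _ (gelt g)) (gmul_suml _ _ z); apply/eq_bigr => h _.
rewrite (gmulZl _ _ z) !(gmulZr _ (gelt g)) (gmulZl _ _ z).
congr (_ *: _); rewrite [z]gelt_span (gmul_sumr _ _ (gelt h)).
rewrite (gmul_sumr _ _ (gelt g)) gmulE (gmul_sumr _ _ (gelt (g * h)%g)).
apply/eq_bigr => k _.
by rewrite (gmulZr _ (gelt h)) !(gmulZr _ (gelt _)) !gmulE mulgA.
Qed.

Lemma gmul1 : left_id (gelt 1%g) gmul.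
Proof.
move=> x; rewrite [x in LHS]gelt_span [RHS]gelt_span gmul_sumr.
by apply/eq_bigr => g _; rewrite gmulZr gmulE mul1g.
Qed.

Lemma g1mul : right_id (gelt 1%g) gmul.
Proof.
move=> x; rewrite [x in LHS]gelt_span [RHS]gelt_span gmul_suml.
by apply/eq_bigr => g _; rewrite gmulZl gmulE mulg1.
Qed.

Lemma gelt1_neq0 : gelt 1%g != 0.
Proof.
by apply/eqP/malgP => /(_ 1%g) /eqP; rewrite mcoeffUU mcoeff0 oner_eq0.
Qed.

HB.instance Definition _ := GRing.Zmodule_isNzRing.Build galg
  gmulA gmul1 g1mul gmulDl gmulDr gelt1_neq0.
HB.instance Definition _ := GRing.Lmodule_isLalgebra.Build R galg
  (fun c x y => esym (gmulZl c x y)).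
HB.instance Definition _ := GRing.Lalgebra_isAlgebra.Build R galg
  (fun c x y => esym (gmulZr c x y)).

Lemma geltM g h : gelt g * gelt h = gelt (g * h)%g.
Proof. exact: gmulE. Qed.

Lemma gelt1 : gelt 1%g = 1.
Proof. by []. Qed.
End GroupAlgebra.

Section GroupAlgebraLift.
Variables (R : comNzRingType) (G : groupType) (A : algType R) (f : G -> A).
Hypotheses (fM : forall g h, f (g * h)%g = f g * f h) (f1 : f 1%g = 1).

Definition glift of (forall g h, f (g * h)%g = f g * f h) & f 1%g = 1 :
  galg R G -> A := glin f.

Local Notation k := (glift fM f1).

Lemma glift_is_linear : linear k.
Proof. exact: glin_is_linear. Qed.

Lemma gliftE g : k (gelt R g) = f g.
Proof. exact: glinE. Qed.

HB.instance Definition _ :=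
  GRing.isLinear.Build R (galg R G) A *:%R (glift fM f1) glift_is_linear.

Lemma gliftZE c g : k (c *: gelt R g) = c *: f g.
Proof. by rewrite (linearZ_LR k) /= gliftE. Qed.

Lemma gliftM_gelt c d g h :
  k (c *: gelt R g * (d *: gelt R h)) = (c *: f g) * (d *: f h).
Proof.
by rewrite -scalerAl -scalerAr geltM scalerA gliftZE fM -scalerAl -scalerAr
   scalerA.
Qed.

Lemma glift_is_monoid_morphism : monoid_morphism k.
Proof.
split=> [|x y]; first by rewrite -gelt1 gliftE.
rewrite [x]gelt_span [y]gelt_span.
rewrite mulr_suml !(raddf_sum k) mulr_suml; apply/eq_bigr => g _.
rewrite mulr_sumr (raddf_sum k) mulr_sumr; apply/eq_bigr => h _.
by rewrite /= gliftM_gelt !gliftZE.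
Qed.
HB.instance Definition _ := GRing.isMonoidMorphism.Build (galg R G) A
  (glift fM f1) glift_is_monoid_morphism.
End GroupAlgebraLift.

Inductive ideal_gen (A : pzRingType) (S : A -> Prop) : A -> Prop :=
| ig_gen u : S u -> ideal_gen S u
| ig_zero : ideal_gen S 0
| ig_add u v : ideal_gen S u -> ideal_gen S v -> ideal_gen S (u + v)
| ig_mull x u : ideal_gen S u -> ideal_gen S (x * u)
| ig_mulr u x : ideal_gen S u -> ideal_gen S (u * x).

Lemma ideal_gen_ker (A B : pzRingType) (f : {rmorphism A -> B})
    (S : A -> Prop) :
  (forall u, S u -> f u = 0) -> forall u, ideal_gen S u -> f u = 0.
Proof.
move=> fS u; elim=> {u} [u /fS //||u v _ fu _ fv|x u _ fu|u x _ fu].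
- exact: rmorph0.
- by rewrite rmorphD fu fv addr0.
- by rewrite rmorphM fu mulr0.
- by rewrite rmorphM fu mul0r.
Qed.

Section AlgebraQuotient.
Variables (R : comNzRingType) (A : algType R) (S : A -> Prop).

Definition ideal_pred : {pred A} := fun u => `[< ideal_gen S u >].

Lemma ideal_predP u : reflect (ideal_gen S u) (u \in ideal_pred).
Proof. exact: asboolP. Qed.

Lemma ideal_pred_zmod : zmod_closed ideal_pred.
Proof.
split=> [|u v /ideal_predP uS /ideal_predP vS]; apply/ideal_predP.
  exact: ig_zero.
by apply: ig_add => //; rewrite -mulN1r; apply: ig_mull.
Qed.
HB.instance Definition _ := GRing.isZmodClosed.Build A ideal_pred
  ideal_pred_zmod.

(* Algebras are nontrivial rings in the library, so the ideal has to be shown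
   to be proper before the quotient can be formed. *)
Definition aquot of ~ ideal_gen S 1 := Quotient.quot ideal_pred.

Hypothesis S1 : ~ ideal_gen S 1.

HB.instance Definition _ := GRing.Zmodule.on (aquot S1).

Definition apr : A -> aquot S1 := \pi_(Quotient.quot ideal_pred).

Lemma apr_eq u v : apr u = apr v <-> ideal_gen S (u - v).
Proof.
rewrite /apr; split=> [/eqP|/ideal_predP uv].
  by rewrite -Quotient.idealrBE => /ideal_predP.
by apply/eqP; rewrite -Quotient.idealrBE.
Qed.

Lemma apr_surj (z : aquot S1) : exists u, z = apr u.
Proof. by exists (repr z); rewrite /apr reprK. Qed.

Lemma apr_is_zmod_morphism : zmod_morphism apr.
Proof. exact: (pi_is_zmod_morphism (Quotient.quot ideal_pred)). Qed.
HB.instance Definition _ := GRing.isZmodMorphism.Build A (aquot S1) apr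
  apr_is_zmod_morphism.

Definition qone : aquot S1 := apr 1.
Definition qmul (z w : aquot S1) : aquot S1 := apr (repr z * repr w).
Definition qscale (c : R) (z : aquot S1) : aquot S1 := apr (c *: repr z).

Lemma repr_apr u : ideal_gen S (repr (apr u) - u).
Proof. by apply/apr_eq; rewrite /apr reprK. Qed.

Lemma qmulE u v : qmul (apr u) (apr v) = apr (u * v).
Proof.
apply/apr_eq; set u' := repr _; set v' := repr _.
have -> : u' * v' - u * v = (u' - u) * v' + u * (v' - v).
  by rewrite mulrBl mulrBr addrA subrK.
by apply: ig_add; [apply: ig_mulr | apply: ig_mull]; apply: repr_apr.
Qed.

Lemma qscaleE c u : qscale c (apr u) = apr (c *: u).
Proof.
apply/apr_eq; rewrite -scalerBr -[c *: _]mulr_algl.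
by apply: ig_mull; apply: repr_apr.
Qed.

Lemma qmulA : associative qmul.
Proof.
move=> x y z; have [u ->] := apr_surj x; have [v ->] := apr_surj y.
by have [w ->] := apr_surj z; rewrite !qmulE mulrA.
Qed.

Lemma qmul1 : left_id qone qmul.
Proof. by move=> x; have [u ->] := apr_surj x; rewrite qmulE mul1r. Qed.

Lemma q1mul : right_id qone qmul.
Proof. by move=> x; have [u ->] := apr_surj x; rewrite qmulE mulr1. Qed.

Lemma qmulDl : left_distributive qmul +%R.
Proof.
move=> x y z; have [u ->] := apr_surj x; have [v ->] := apr_surj y.
by have [w ->] := apr_surj z; rewrite -raddfD !qmulE -raddfD mulrDl.
Qed.

Lemma qmulDr : right_distributive qmul +%R.
Proof.
move=> x y z; have [u ->] := apr_surj x; have [v ->] := apr_surj y.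
by have [w ->] := apr_surj z; rewrite -raddfD !qmulE -raddfD mulrDr.
Qed.

Lemma qone_neq0 : qone != 0.
Proof.
apply/eqP; rewrite /qone -[0](raddf0 apr) => /apr_eq; rewrite subr0.
exact: S1.
Qed.

HB.instance Definition _ := GRing.Zmodule_isNzRing.Build (aquot S1)
  qmulA qmul1 q1mul qmulDl qmulDr qone_neq0.

Lemma qscaleA a b x : qscale a (qscale b x) = qscale (a * b) x.
Proof. by have [u ->] := apr_surj x; rewrite !qscaleE scalerA. Qed.

Lemma qscale1 : left_id 1 qscale.
Proof. by move=> x; have [u ->] := apr_surj x; rewrite qscaleE scale1r. Qed.

Lemma qscaleDr : right_distributive qscale +%R.
Proof.
move=> c x y; have [u ->] := apr_surj x; have [v ->] := apr_surj y.
by rewrite -raddfD !qscaleE -raddfD scalerDr.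
Qed.

Lemma qscaleDl x : {morph qscale^~ x : a b / a + b}.
Proof.
by move=> a b; have [u ->] := apr_surj x; rewrite !qscaleE -raddfD scalerDl.
Qed.

HB.instance Definition _ := GRing.Zmodule_isLmodule.Build R (aquot S1)
  qscaleA qscale1 qscaleDr qscaleDl.

Lemma qscaleAl c x y : qscale c (qmul x y) = qmul (qscale c x) y.
Proof.
have [u ->] := apr_surj x; have [v ->] := apr_surj y.
by rewrite !(qmulE, qscaleE) scalerAl.
Qed.

Lemma qscaleAr c x y : qscale c (qmul x y) = qmul x (qscale c y).
Proof.
have [u ->] := apr_surj x; have [v ->] := apr_surj y.
by rewrite !(qmulE, qscaleE) scalerAr.
Qed.

HB.instance Definition _ := GRing.Lmodule_isLalgebra.Build R (aquot S1)
  qscaleAl.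
HB.instance Definition _ := GRing.Lalgebra_isAlgebra.Build R (aquot S1)
  qscaleAr.

Lemma apr_is_monoid_morphism : monoid_morphism apr.
Proof. by split=> // u v; rewrite [RHS]qmulE. Qed.
HB.instance Definition _ := GRing.isMonoidMorphism.Build A (aquot S1) apr
  apr_is_monoid_morphism.

Lemma apr_is_scalable : scalable apr.
Proof. by move=> c u; rewrite [RHS]qscaleE. Qed.
HB.instance Definition _ := GRing.isScalable.Build R A (aquot S1) *:%R apr
  apr_is_scalable.

Lemma apr_eq0 u : S u -> apr u = 0.
Proof.
by move=> Su; rewrite -[0](raddf0 apr); apply/apr_eq; rewrite subr0; apply: ig_gen.
Qed.

End AlgebraQuotient.

Section QuotientLift.
Variables (R : comNzRingType) (A : algType R) (S : A -> Prop).
Hypothesis S1 : ~ ideal_gen S 1.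
Variables (B : algType R) (f : {lrmorphism A -> B}).
Hypothesis fS : forall u, S u -> f u = 0.

Definition alift of (forall u, S u -> f u = 0) : aquot S1 -> B :=
  fun z => f (repr z).

Lemma aliftE u : alift fS (apr S1 u) = f u.
Proof.
apply/eqP; rewrite -subr_eq0 /alift -rmorphB; apply/eqP.
exact/(ideal_gen_ker fS)/repr_apr.
Qed.

Lemma alift_is_linear : linear (alift fS).
Proof.
move=> c x y; have [u ->] := apr_surj x; have [v ->] := apr_surj y.
by rewrite -linearP !aliftE linearP.
Qed.
HB.instance Definition _ := GRing.isLinear.Build R (aquot S1) B *:%R
  (alift fS) alift_is_linear.

Lemma alift_is_monoid_morphism : monoid_morphism (alift fS).
Proof.
split=> [|x y]; first by rewrite -(rmorph1 (apr S1)) aliftE rmorph1.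
have [u ->] := apr_surj x; have [v ->] := apr_surj y.
by rewrite -rmorphM !aliftE rmorphM.
Qed.
HB.instance Definition _ := GRing.isMonoidMorphism.Build (aquot S1) B
  (alift fS) alift_is_monoid_morphism.
End QuotientLift.

Arguments alift {R A S} S1 {B f} _ _.
Arguments aliftE {R A S} S1 {B f} _ _.

(* The subring [D[1/m]] of the fraction field of [D], for nonzero [m] *)
Section Localization.
Variables (D : idomainType) (m : D).

Definition loc_pred : {pred {fraction D}} :=
  fun z => `[< exists p k, z * tofrac m ^+ k = tofrac p >].

Lemma loc_pred_subring : subring_closed loc_pred.
Proof.
split=> [|z w /asboolP[p [k zp]] /asboolP[q [l wq]]
         |z w /asboolP[p [k zp]] /asboolP[q [l wq]]]; apply/asboolP.
- by exists 1, 0; rewrite expr0 mulr1 rmorph1.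
- exists (p * m ^+ l - q * m ^+ k), (k + l)%N.
  rewrite rmorphB !rmorphM !rmorphXn /= -zp -wq mulrBl exprD.
  by rewrite !mulrA; congr (_ - _); rewrite mulrAC.
- exists (p * q), (k + l)%N.
  by rewrite rmorphM /= -zp -wq exprD mulrACA.
Qed.
HB.instance Definition _ := GRing.isSubringClosed.Build {fraction D} loc_pred
  loc_pred_subring.

Record localization : predArgType :=
  Localization { loc_val : {fraction D}; _ : loc_val \in loc_pred }.
HB.instance Definition _ := [isSub for loc_val].
HB.instance Definition _ := [Choice of localization by <:].
HB.instance Definition _ :=
  [SubChoice_isSubComNzRing of localization by <:].

Lemma loc_in_subproof (p : D) : tofrac p \in loc_pred.
Proof. by apply/asboolP; exists p, 0; rewrite expr0 mulr1. Qed.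
Definition loc_in (p : D) : localization := Localization (loc_in_subproof p).

Lemma loc_inM p q : loc_in (p * q) = loc_in p * loc_in q.
Proof. by apply/val_inj; rewrite /= rmorphM. Qed.

Hypothesis m0 : m != 0.

Lemma loc_inv_subproof : (tofrac m)^-1 \in loc_pred.
Proof.
by apply/asboolP; exists 1, 1; rewrite expr1 mulVf ?rmorph1 // tofrac_eq0.
Qed.
Definition loc_inv : localization := Localization loc_inv_subproof.

Lemma loc_inV : loc_in m * loc_inv = 1.
Proof. by apply/val_inj; rewrite /= mulfV // tofrac_eq0. Qed.
End Localization.

Module Base.
Import mpoly.

Definition Qabc : idomainType := {mpoly rat[3]}.
Definition Xa : Qabc := 'X_(inord 0 : 'I_3).
Definition Xb : Qabc := 'X_(inord 1 : 'I_3).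
Definition Xc : Qabc := 'X_(inord 2 : 'I_3).

Definition Xabc : Qabc := Xa * Xb * Xc.

Lemma Xabc_neq0 : Xabc != 0.
Proof. by rewrite !mulf_neq0 // -msupp_eq0 msuppX. Qed.

Definition R := localization Xabc.
HB.instance Definition _ := GRing.ComNzRing.on R.
Definition a : R := loc_in _ Xa.
Definition b : R := loc_in _ Xb.
Definition c : R := loc_in _ Xc.

Definition abc_inv : R := loc_inv Xabc_neq0.
Lemma abcV : a * b * c * abc_inv = 1.
Proof. by rewrite -!loc_inM loc_inV. Qed.

Definition bV : R := a * c * abc_inv.
Lemma bVK : b * bV = 1.
Proof. by rewrite /bV !mulrA [b * a]mulrC abcV. Qed.
End Base.

Local Notation R := Base.R.

(* The Artin generators [s_1, ..., s_(n-1)] are indexed from 0 by ['I_n.-1]. *)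
Inductive braid_rel (n : nat) : word 'I_n.-1 -> word 'I_n.-1 -> Prop :=
| braid_far (i j : 'I_n.-1) : (i.+1 < j)%N ->
    braid_rel [:: (i, false); (j, false)] [:: (j, false); (i, false)]
| braid_adj (i j : 'I_n.-1) : j = i.+1 :> nat ->
    braid_rel [:: (i, false); (j, false); (i, false)]
              [:: (j, false); (i, false); (j, false)].

Definition braid (n : nat) := presented (@braid_rel n).
HB.instance Definition _ n := Group.on (braid n).

Definition artin (n : nat) (i : 'I_n.-1) : braid n := pgen (@braid_rel n) i.

Section Relators.
Variables (K : comNzRingType) (A : algType K) (a b c : K).

Definition quadratic_elt (s : A) : A := (s - b%:A) * (s - c%:A).

Definition cubic_elt (s : A) : A := (s - a%:A) * (s - b%:A) * (s - c%:A).

(* [si], [siV], [sj], [sjV] stand for [s_i], [s_i^-1], [s_(i+1)],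
   [s_(i+1)^-1]. *)
Definition bmw_elt (si siV sj sjV : A) : A :=
  let x := b + c in
  let y := b * c in
  - (y *: (si * sjV * si))
  + y ^+ 2 *: (sjV * si * sjV)
  - si * sj * si
  - (x * y ^+ 2) *: sjV ^+ 2
  + x *: si ^+ 2
  + y ^+ 3 *: (sjV * siV * sjV).
End Relators.

Section RelatorMorph.
Variables (K : comNzRingType) (A B : algType K) (f : {lrmorphism A -> B}).
Variables (a b c : K).

Lemma lrmorph_alg (k : K) : f k%:A = k%:A.
Proof. by rewrite linearZ /= rmorph1. Qed.

Lemma rmorph_cubic s : f (cubic_elt a b c s) = cubic_elt a b c (f s).
Proof. by rewrite /cubic_elt !rmorphM !rmorphB /= !lrmorph_alg. Qed.

Lemma rmorph_quadratic s : f (quadratic_elt b c s) = quadratic_elt b c (f s).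
Proof. by rewrite /quadratic_elt rmorphM !rmorphB /= !lrmorph_alg. Qed.

Lemma rmorph_bmw s s' t t' :
  f (bmw_elt b c s s' t t') = bmw_elt b c (f s) (f s') (f t) (f t').
Proof.
rewrite /bmw_elt /= !(rmorphD f, rmorphB f, rmorphN f) /= !(linearZ_LR f) /=.
by rewrite !(rmorphXn f) !(rmorphM f).
Qed.
End RelatorMorph.

(* The relators vanish under [s_i |-> b]. *)
Section RelatorChar.
Variables (K : comNzRingType) (a b c d : K).

Lemma cubic_chr : cubic_elt a b c (b : K^o) = 0.
Proof. by rewrite /cubic_elt /GRing.scale /= mulr1 mulr1 subrr mulr0 mul0r. Qed.

Lemma quadratic_chr : quadratic_elt b c (b : K^o) = 0.
Proof. by rewrite /quadratic_elt /GRing.scale /= mulr1 subrr mul0r. Qed.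

Lemma bmw_chr : b * d = 1 ->
  bmw_elt b c (b : K^o) (d : K^o) (b : K^o) (d : K^o) = 0.
Proof.
move=> bd; pose t := b * d.
transitivity (- (b ^+ 2 * c * t) + b * c ^+ 2 * t ^+ 2 - b ^+ 3
  - (b + c) * c ^+ 2 * t ^+ 2 + (b + c) * b ^+ 2 + c ^+ 3 * t ^+ 3).
  by rewrite /bmw_elt /GRing.scale /= /t; ring.
by rewrite /t bd; ring.
Qed.
End RelatorChar.

Definition RB (n : nat) := galg R (braid n).
HB.instance Definition _ n := GRing.Algebra.on (RB n).

Section Algebras.
Variable n : nat.

Definition RBgen (i : 'I_n.-1) : RB n := gelt R (artin i).

Definition cubic_relator (u : RB n) : Prop :=
  exists i, u = cubic_elt Base.a Base.b Base.c (RBgen i).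

Definition quadratic_relator (u : RB n) : Prop :=
  exists i, u = quadratic_elt Base.b Base.c (RBgen i).

(* The character [s_i |-> b] of the group algebra: it shows that the ideals
   below are proper. *)
Definition chr_letter (l : 'I_n.-1 * bool) : R^o := if l.2 then Base.bV else Base.b.
Definition chr_braid (g : braid n) : R^o := \prod_(l <- repr g) chr_letter l.

Lemma chr_letterV l : chr_letter l * chr_letter (letter_inv l) = 1.
Proof.
by case: l => i []; rewrite /chr_letter /= ?Base.bVK // mulrC Base.bVK.
Qed.

Lemma chr_rel u v : braid_rel u v ->
  \prod_(l <- u) chr_letter l = \prod_(l <- v) chr_letter l.
Proof. by case=> i j _; rewrite !big_cons !big_nil. Qed.

Definition chr : RB n -> R^o :=
  @glift R (braid n) R^o chr_braid
    (prod_reprM chr_letterV chr_rel) (prod_repr1 chr_letterV chr_rel).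
HB.instance Definition _ := GRing.LRMorphism.on chr.

Lemma chr_gelt g : chr (gelt R g) = chr_braid g.
Proof. exact: gliftE. Qed.

Lemma chr_gen i : chr (RBgen i) = Base.b.
Proof.
rewrite chr_gelt /chr_braid (prod_repr_word chr_letterV chr_rel).
by rewrite big_seq1.
Qed.

Lemma chr_genV i : chr (gelt R (artin i)^-1%g) = Base.bV.
Proof.
rewrite chr_gelt /chr_braid /artin /pgen pwordV.
by rewrite (prod_repr_word chr_letterV chr_rel) big_seq1.
Qed.

Lemma chr_cubic u : cubic_relator u -> chr u = 0.
Proof. by case=> i ->; rewrite rmorph_cubic /= chr_gen cubic_chr. Qed.

Lemma chr_quadratic u : quadratic_relator u -> chr u = 0.
Proof. by case=> i ->; rewrite rmorph_quadratic /= chr_gen quadratic_chr. Qed.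

Lemma chr_proper (S : RB n -> Prop) :
  (forall u, S u -> chr u = 0) -> ~ ideal_gen S 1.
Proof.
move=> S0 /(ideal_gen_ker S0); rewrite rmorph1 => /eqP.
by rewrite oner_eq0.
Qed.

Lemma cubic_proper : ~ ideal_gen cubic_relator 1.
Proof. exact/chr_proper/chr_cubic. Qed.

Lemma quadratic_proper : ~ ideal_gen quadratic_relator 1.
Proof. exact/chr_proper/chr_quadratic. Qed.

Definition H : algType R := aquot cubic_proper.
Definition Hecke : algType R := aquot quadratic_proper.
Definition RB_to_H : {lrmorphism RB n -> H} := apr cubic_proper.
Definition RB_to_Hecke : {lrmorphism RB n -> Hecke} := apr quadratic_proper.

Definition Hs (i : 'I_n.-1) : H := RB_to_H (gelt R (artin i)).
Definition HsV (i : 'I_n.-1) : H := RB_to_H (gelt R (artin i)^-1%g).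

Definition bmw_relator (u : H) : Prop :=
  exists i j : 'I_n.-1, j = i.+1 :> nat /\ 
    u = bmw_elt Base.b Base.c (Hs i) (HsV i) (Hs j) (HsV j).

Definition chrH : {lrmorphism H -> R^o} := alift cubic_proper chr_cubic.

Lemma chrH_s i : chrH (Hs i) = Base.b.
Proof. exact: etrans (aliftE _ _ _) (chr_gen i). Qed.

Lemma chrH_sV i : chrH (HsV i) = Base.bV.
Proof. exact: etrans (aliftE _ _ _) (chr_genV i). Qed.

Lemma chr_bmw u : bmw_relator u -> chrH u = 0.
Proof.
case=> i [j [_ ->]].
by rewrite rmorph_bmw !chrH_s !chrH_sV (bmw_chr _ Base.bVK).
Qed.

Lemma bmw_proper : ~ ideal_gen bmw_relator 1.
Proof.
move=> /(ideal_gen_ker chr_bmw); rewrite rmorph1 => /eqP.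
by rewrite oner_eq0.
Qed.

(* This is a quotient of the cubic Hecke algebra [H], not the usual
   Birman-Murakami-Wenzl algebra. *)
Definition BMW : algType R := aquot bmw_proper.
Definition H_to_BMW : {lrmorphism H -> BMW} := apr bmw_proper.

Definition BMWs (i : 'I_n.-1) : BMW := H_to_BMW (Hs i).
Definition BMWsV (i : 'I_n.-1) : BMW := H_to_BMW (HsV i).

Lemma RB_to_Hecke_cubic u : cubic_relator u -> RB_to_Hecke u = 0.
Proof.
case=> i ->; rewrite /cubic_elt -mulrA rmorphM /=.
have -> : RB_to_Hecke (quadratic_elt Base.b Base.c (RBgen i)) = 0.
  by apply: apr_eq0; exists i.
by rewrite mulr0.
Qed.

Definition H_to_Hecke : {lrmorphism H -> Hecke} :=
  alift cubic_proper RB_to_Hecke_cubic.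

Lemma H_to_HeckeE u : H_to_Hecke (RB_to_H u) = RB_to_Hecke u.
Proof. exact: aliftE. Qed.
End Algebras.

Lemma H_to_Hecke_s (n : nat) (i : 'I_n.-1) :
  H_to_Hecke n (Hs i) = RB_to_Hecke n (RBgen i).
Proof. exact: H_to_HeckeE. Qed.

Section Inclusion.
Variable n : nat.

Definition widen_gen (i : 'I_n.-1) : 'I_n.+1.-1 := widen_ord (leq_pred n) i.
Definition widen_word (u : word 'I_n.-1) : word 'I_n.+1.-1 :=
  [seq (widen_gen l.1, l.2) | l <- u].

Lemma widen_word_cong u v :
  word_cong (@braid_rel n) u v ->
  word_cong (@braid_rel n.+1) (widen_word u) (widen_word v).
Proof.
elim=> {u v} [u|u v _|u v w _ uv _ vw|u u' v v' _ IHu _ IHv|l|u v uv].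
- exact: wc_refl.
- exact: wc_sym.
- exact: wc_trans uv vw.
- by rewrite /widen_word !map_cat; apply: wc_cat.
- exact: (wc_inv _ (widen_gen l.1, l.2)).
- by apply: wc_rel; case: uv => i j ij; [apply: braid_far|apply: braid_adj].
Qed.

Definition braid_inc (g : braid n) : braid n.+1 :=
  pword (@braid_rel n.+1) (widen_word (repr g)).

Lemma braid_incE u :
  braid_inc (pword (@braid_rel n) u) =
    pword (@braid_rel n.+1) (widen_word u).
Proof. exact/pword_eq/widen_word_cong/repr_pword. Qed.

Lemma braid_inc1 : braid_inc 1%g = 1%g.
Proof. exact: (braid_incE [::]). Qed.

Lemma braid_incM g h : braid_inc (g * h)%g = (braid_inc g * braid_inc h)%g.
Proof.
have [u ->] := pwordP g; have [v ->] := pwordP h.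
by rewrite pwordM !braid_incE pwordM /widen_word map_cat.
Qed.
HB.instance Definition _ := isUMagmaMorphism.Build (braid n) (braid n.+1)
  braid_inc (pair braid_inc1 braid_incM).

Lemma braid_inc_artin i : braid_inc (artin i) = artin (widen_gen i).
Proof. exact: braid_incE. Qed.

Lemma RB_inc_subproof g h :
  gelt R (braid_inc (g * h)%g) = gelt R (braid_inc g) * gelt R (braid_inc h).
Proof. by rewrite braid_incM geltM. Qed.

Lemma RB_inc_subproof1 : gelt R (braid_inc 1%g) = 1.
Proof. by rewrite braid_inc1 gelt1. Qed.

Definition RB_inc : {lrmorphism RB n -> RB n.+1} :=
  @glift R (braid n) (RB n.+1) (fun g => gelt R (braid_inc g))
    RB_inc_subproof RB_inc_subproof1.

Lemma RB_incE g : RB_inc (gelt R g) = gelt R (braid_inc g).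
Proof. exact: gliftE. Qed.

Lemma RB_to_H_inc_cubic u :
  cubic_relator u -> (RB_to_H n.+1 \o RB_inc) u = 0.
Proof.
case=> i ->; rewrite /comp rmorph_cubic RB_incE braid_inc_artin.
by apply: apr_eq0; exists (widen_gen i).
Qed.

Definition H_inc : {lrmorphism H n -> H n.+1} :=
  alift (@cubic_proper n) RB_to_H_inc_cubic.

Lemma H_incE u : H_inc (RB_to_H n u) = RB_to_H n.+1 (RB_inc u).
Proof. exact: aliftE. Qed.

Lemma H_inc_s i : H_inc (Hs i) = Hs (widen_gen i).
Proof. by rewrite /Hs H_incE RB_incE braid_inc_artin. Qed.

Lemma H_inc_sV i : H_inc (HsV i) = HsV (widen_gen i).
Proof.
rewrite /HsV H_incE RB_incE; congr (RB_to_H _ (gelt _ _)).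
by rewrite /artin /pgen !pwordV; apply: braid_incE.
Qed.

Lemma H_to_BMW_inc_bmw u :
  bmw_relator u -> (H_to_BMW n.+1 \o H_inc) u = 0.
Proof.
case=> i [j [ij ->]]; rewrite /comp rmorph_bmw !H_inc_s !H_inc_sV.
by apply: apr_eq0; exists (widen_gen i), (widen_gen j).
Qed.

Definition BMW_inc : {lrmorphism BMW n -> BMW n.+1} :=
  alift (@bmw_proper n) H_to_BMW_inc_bmw.

Lemma BMW_incE u : BMW_inc (H_to_BMW n u) = H_to_BMW n.+1 (H_inc u).
Proof. exact: aliftE. Qed.

Lemma BMW_inc_s i : BMW_inc (BMWs i) = BMWs (widen_gen i).
Proof. by rewrite /BMWs BMW_incE H_inc_s. Qed.

End Inclusion.

(* The additive subgroup [P s P] spanned by the products [p * s * q] with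
   [p], [q] in [P]. *)
Definition bispan (A : pzRingType) (P : A -> Prop) (s : A) : A -> Prop :=
  fun z => exists l : seq (A * A),
    (forall p, p \in l -> P p.1 /\ P p.2) /\ z = \sum_(p <- l) p.1 * s * p.2.

Definition image_of (U V : Type) (f : U -> V) : V -> Prop :=
  fun z => exists u, f u = z.

Definition fin_gen_module (K : pzRingType) (V : lmodType K) : Prop :=
  exists (k : nat) (v : 'I_k -> V),
    forall z : V, exists r : 'I_k -> K, z = \sum_(i < k) r i *: v i.

(* Main.v *)
(* In the Hecke algebra [y s^-1 = x - s], and substituting this in the relator
   gives [0] identically.

   For the decomposition, write [U = A + A s A + A s^-1 A], where [A] is the
   image of [BMW_n] and [s = s_n].  It is stable under left multiplication by
   [A], so it is everything as soon as [s^e A s^f] lies in [U] for all signs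
   [e], [f].  Inductively [A = A' + A' t A' + A' t^-1 A'] with [t = s_(n-1)]
   and [A'] commuting with [s], which leaves the eight products
   [s^e t^g s^f].  Six of them are handled by the braid relation.  The relator
   expresses [y^2 s^-1 t s^-1] in [U], and [y] is invertible.  Finally, the
   cubic relation puts [s] in the span of [1], [s^-1] and [s^-2], which reduces
   [s t^-1 s] to [s^-2 t^-1 s = s^-1 t s^-1 t^-1].  Finite generation follows
   by induction from this decomposition. *)
Require Import Defs.
From HB Require Import structures.
From mathcomp Require Import all_boot all_order all_algebra.
From mathcomp Require Import ring.

Set Implicit Arguments.
Unset Strict Implicit.
Unset Printing Implicit Defensive.

Import GRing.Theory.
Local Open Scope ring_scope.

Lemma zmod_eq_of_sum0 (V : zmodType) (x y z w : V) :
  x - y + z - w = 0 -> x = y - z + w.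
Proof.
move=> /eqP; rewrite subr_eq0 => /eqP <-.
by rewrite addrC -addrA (addrCA z) subrr addr0 subrK.
Qed.

Lemma zmod_cancel (V : zmodType) (x y z w : V) :
  - (x - y) + w - y - z + x + (z - w) = 0.
Proof.
rewrite opprB (addrAC _ w) (addrAC y) subrr add0r.
by rewrite (addrAC _ _ x) (addrAC _ w) addNr add0r addrA subrK subrr.
Qed.

Lemma inverse_unique (B : pzRingType) (x m y : B) :
  x * m = 1 -> m * y = 1 -> x = y.
Proof. by move=> xm my; rewrite -[x]mulr1 -my mulrA xm mul1r. Qed.

Lemma comm_inverse (B : pzRingType) (x u v : B) :
  u * v = 1 -> v * u = 1 -> GRing.comm x u -> GRing.comm x v.
Proof.
move=> uv vu xu; rewrite /GRing.comm -[x * v]mul1r -vu.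
by rewrite -!mulrA (mulrA u) -xu -(mulrA x) uv mulr1.
Qed.

Section Cubic.
Variables (K : comNzRingType) (B : algType K) (a b c d : K) (s sV : B).
Hypotheses (sK : s * sV = 1) (sVK : sV * s = 1).
Hypotheses (abcd : a * b * c * d = 1) (s_cubic : cubic_elt a b c s = 0).

Let e1 := a + b + c.
Let e2 := a * b + b * c + c * a.
Let e3 := a * b * c.

Lemma cubic_expand : s ^+ 3 - e1 *: s ^+ 2 + e2 *: s - e3%:A = 0.
Proof.
pose p : {poly K} := ('X - a%:P) * ('X - b%:P) * ('X - c%:P).
have <- : horner_alg s p = 0.
  by rewrite /p !rmorphM !rmorphB /= horner_algX !horner_algC.
have -> : p = 'X ^+ 3 - e1%:P * 'X ^+ 2 + e2%:P * 'X - e3%:P.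
  rewrite /p !(rmorphD, rmorphM) /=; ring.
move: e1 e2 e3 => f1 f2 f3.
by rewrite !(rmorphD, rmorphN, rmorphM, rmorphXn) /= horner_algX !horner_algC
  !mulr_algl.
Qed.

Lemma cubic_sqr : s * s = e1 *: s - e2%:A + e3 *: sV.
Proof.
have /(congr1 ( *%R^~ sV)) := cubic_expand.
rewrite mul0r !(mulrDl, mulNr) -!scalerAl mul1r sK.
rewrite exprSr expr2 -!(mulrA _ s sV) sK !mulr1.
exact: zmod_eq_of_sum0.
Qed.

Lemma cubic_lin : s = e1%:A - e2 *: sV + e3 *: (sV * sV).
Proof.
have /(congr1 ( *%R sV)) := cubic_sqr.
by rewrite mulrA sVK mul1r !(mulrDr, mulrN) -!scalerAr mulr1 sVK.
Qed.

Lemma cubic_sqrV : sV * sV = d *: s - (d * e1)%:A + (d * e2) *: sV.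
Proof.
rewrite {1}cubic_lin !scalerDr scalerN !scalerA [d * e3]mulrC abcd scale1r.
rewrite 2!(addrAC _ (sV * sV)) (addrAC ((d * e1)%:A)).
by rewrite subrr add0r addNr add0r.
Qed.
End Cubic.

Section QuadraticBMW.
Variables (K : comNzRingType) (B : algType K) (b c : K).

Lemma quadratic_inv (u uV : B) : u * uV = 1 -> quadratic_elt b c u = 0 ->
  (b * c) *: uV = (b + c)%:A - u.
Proof.
move=> uK /(congr1 ( *%R^~ uV)); rewrite mul0r /quadratic_elt.
rewrite -mulrA !mulrBl uK mulr_algl mulrBr mulr1 -scalerAr uK mulr_algl.
rewrite scalerDl scalerBr scalerA opprB addrA => /eqP.
rewrite subr_eq0 => /eqP <-.
by rewrite (addrAC _ _ c%:A) subrK addrAC subrr add0r.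
Qed.

Lemma bmw_elt_quadratic (s sV t tV : B) : s * sV = 1 -> t * tV = 1 ->
  quadratic_elt b c s = 0 -> quadratic_elt b c t = 0 ->
  bmw_elt b c s sV t tV = 0.
Proof.
move=> sK tK /(quadratic_inv sK) Es /(quadratic_inv tK) Et.
rewrite /bmw_elt; move: (b * c) (b + c) Es Et => y x Es Et.
have -> : y *: (s * tV * s) = x *: s ^+ 2 - s * t * s.
  by rewrite scalerAl scalerAr Et mulrBr mulrBl mulr_algr -scalerAl.
have -> : y ^+ 2 *: (tV * s * tV) = (y *: tV) * s * (y *: tV).
  by rewrite -scalerAr -!scalerAl scalerA.
have -> : (x * y ^+ 2) *: tV ^+ 2 = x *: ((y *: tV) * (y *: tV)).
  by rewrite -scalerAr -!scalerAl !scalerA mulrA.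
have -> : y ^+ 3 *: (tV * sV * tV) =
    x *: ((y *: tV) * (y *: tV)) - (y *: tV) * s * (y *: tV).
  transitivity ((y *: tV) * (y *: sV) * (y *: tV)).
    by rewrite -!scalerAr -!scalerAl !scalerA exprS expr2 mulrA.
  by rewrite Es mulrBr mulrBl mulr_algr -scalerAl.
exact: zmod_cancel.
Qed.
End QuadraticBMW.

Section Triple.
Variables (K : comNzRingType) (B : algType K).

Record subalgebra (A : B -> Prop) : Prop := Subalgebra {
  subalg1 : A 1;
  subalgD : forall u v, A u -> A v -> A (u + v);
  subalgM : forall u v, A u -> A v -> A (u * v);
  subalgZ : forall k u, A u -> A (k *: u) }.

Definition triple (A : B -> Prop) (s sV z : B) : Prop :=
  exists u v w, [/\ A u, bispan A s v, bispan A sV w & z = u + v + w].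

Section Bispan.
Variables (A : B -> Prop) (s : B).
Hypothesis Aalg : subalgebra A.

Lemma subalg0 : A 0.
Proof. by rewrite -(scale0r 1); apply/(subalgZ Aalg)/(subalg1 Aalg). Qed.

Lemma bispan0 : bispan A s 0.
Proof. by exists [::]; split=> //; rewrite big_nil. Qed.

Lemma bispan_gen p q : A p -> A q -> bispan A s (p * s * q).
Proof.
move=> Ap Aq; exists [:: (p, q)]; split; last by rewrite big_seq1.
by move=> r; rewrite inE => /eqP->.
Qed.

Lemma bispanD u v : bispan A s u -> bispan A s v -> bispan A s (u + v).
Proof.
move=> [l [lA ->]] [m [mA ->]]; exists (l ++ m); split; last by rewrite big_cat.
by move=> p; rewrite mem_cat => /orP[/lA|/mA].
Qed.

Lemma bispan_mull a u : A a -> bispan A s u -> bispan A s (a * u).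
Proof.
move=> Aa [l [lA ->]]; exists [seq (a * p.1, p.2) | p <- l]; split.
  by move=> _ /mapP[p /lA[A1 A2] ->]; split=> //; apply: (subalgM Aalg).
by rewrite big_map mulr_sumr; apply: eq_bigr => p _; rewrite !mulrA.
Qed.

Lemma bispan_mulr a u : A a -> bispan A s u -> bispan A s (u * a).
Proof.
move=> Aa [l [lA ->]]; exists [seq (p.1, p.2 * a) | p <- l]; split.
  by move=> _ /mapP[p /lA[A1 A2] ->]; split=> //; apply: (subalgM Aalg).
by rewrite big_map mulr_suml; apply: eq_bigr => p _; rewrite !mulrA.
Qed.

Lemma bispan_ind (P : B -> Prop) :
  P 0 -> (forall u v, P u -> P v -> P (u + v)) ->
  (forall p q, A p -> A q -> P (p * s * q)) ->
  forall z, bispan A s z -> P z.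
Proof.
move=> P0 PD Ps _ [l [lA ->]]; rewrite big_seq.
by apply: (big_ind P) => // p /lA[]; apply: Ps.
Qed.
End Bispan.

Section TripleTheory.
Variables (A : B -> Prop) (s sV : B).
Hypothesis Aalg : subalgebra A.
Local Notation U := (triple A s sV).
Local Notation g e := (if e : bool then sV else s).

Lemma triple_base u : A u -> U u.
Proof.
by move=> Au; exists u, 0, 0; rewrite !addr0; split=> //; apply: bispan0.
Qed.

Lemma triple_gen e p q : A p -> A q -> U (p * g e * q).
Proof.
have A0 := subalg0 Aalg; move=> Ap Aq; case: e.
  exists 0, 0, (p * sV * q); rewrite !add0r.
  by split=> //; [apply: bispan0 | apply: bispan_gen].
exists 0, (p * s * q), 0; rewrite add0r addr0.
by split=> //; [apply: bispan_gen | apply: bispan0].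
Qed.

Lemma tripleD z w : U z -> U w -> U (z + w).
Proof.
move=> [u [v [x [Au sv sx ->]]]] [u' [v' [x' [Au' sv' sx' ->]]]].
exists (u + u'), (v + v'), (x + x'); rewrite addrACA (addrACA u v).
by split=> //; [apply: (subalgD Aalg) | apply: bispanD | apply: bispanD].
Qed.

Lemma triple_mull a z : A a -> U z -> U (a * z).
Proof.
move=> Aa [u [v [w [Au sv sw ->]]]]; exists (a * u), (a * v), (a * w).
by rewrite !mulrDr; split=> //; [apply: (subalgM Aalg) | apply: bispan_mull..].
Qed.

Lemma triple_mulr a z : A a -> U z -> U (z * a).
Proof.
move=> Aa [u [v [w [Au sv sw ->]]]]; exists (u * a), (v * a), (w * a).
by rewrite !mulrDl; split=> //; [apply: (subalgM Aalg) | apply: bispan_mulr..].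
Qed.

Lemma tripleZ k z : U z -> U (k *: z).
Proof.
by rewrite -mulr_algl; apply/triple_mull/(subalgZ Aalg)/(subalg1 Aalg).
Qed.

Lemma tripleN z : U z -> U (- z).
Proof. by rewrite -scaleN1r; apply: tripleZ. Qed.

Lemma triple_ind (P : B -> Prop) :
  (forall u v, P u -> P v -> P (u + v)) -> (forall u, A u -> P u) ->
  (forall e p q, A p -> A q -> P (p * g e * q)) ->
  forall z, U z -> P z.
Proof.
move=> PD PA Pg z [u [v [w [Au sv sw ->]]]].
have P0 : P 0 by apply: PA; apply: subalg0.
apply: (PD); [apply: (PD); first exact: PA|].
  by apply: (bispan_ind P0 PD) sv => p q; apply: (Pg false).
by apply: (bispan_ind P0 PD) sw => p q; apply: (Pg true).
Qed.

Lemma triple_letter e : U (g e).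
Proof.
by rewrite -[g e]mulr1 -[g e]mul1r; apply: triple_gen; apply: (subalg1 Aalg).
Qed.

Lemma triple_stable :
  (forall e f u, A u -> U (g e * u * g f)) ->
  forall e z, U z -> U (g e * z).
Proof.
move=> Ugg e; apply: triple_ind => [u v||f p q Ap Aq].
- by rewrite mulrDr; apply: tripleD.
- by move=> u Au; apply: triple_mulr => //; apply: triple_letter.
- by rewrite !mulrA; apply: triple_mulr => //; apply: Ugg.
Qed.

Section CubicTriple.
Variables (a b c d : K).
Hypotheses (sK : s * sV = 1) (sVK : sV * s = 1).
Hypotheses (abcd : a * b * c * d = 1) (s_cubic : cubic_elt a b c s = 0).

Lemma triple_letter2 e f : U (g e * g f).
Proof.
have UA k : U k%:A by apply/triple_base/(subalgZ Aalg)/(subalg1 Aalg).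
have Us : U s := triple_letter false; have UsV : U sV := triple_letter true.
have U1 : U 1 by apply: triple_base; apply: subalg1.
case: e; case: f; rewrite ?sK ?sVK //.
  rewrite (cubic_sqrV sK sVK abcd s_cubic).
  apply: tripleD (tripleZ _ UsV) => //.
  by apply: tripleD (tripleN (UA _)) => //; apply: tripleZ.
rewrite (cubic_sqr sK s_cubic).
apply: tripleD (tripleZ _ UsV) => //.
by apply: tripleD (tripleN (UA _)) => //; apply: tripleZ.
Qed.
End CubicTriple.
End TripleTheory.
End Triple.

Section BraidIdentities.
Variables (B : pzRingType) (s sV t tV : B).
Hypotheses (sK : s * sV = 1) (sVK : sV * s = 1).
Hypotheses (tK : t * tV = 1) (tVK : tV * t = 1).
Hypothesis braid : s * t * s = t * s * t.

Lemma braid_slide : s * t * sV = tV * s * t.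
Proof.
have := congr1 (fun z => tV * z * sV) braid.
by rewrite !mulrA tVK mul1r -(mulrA _ s sV) sK mulr1.
Qed.

Lemma braidV : sV * tV * sV = tV * sV * tV.
Proof.
apply: (@inverse_unique _ _ (s * t * s)); last rewrite braid.
  by rewrite !mulrA -(mulrA _ sV s) sVK mulr1 -(mulrA _ tV t) tVK mulr1.
by rewrite !mulrA -(mulrA _ t tV) tK mulr1 -(mulrA _ s sV) sK mulr1.
Qed.
End BraidIdentities.

Section TripleStep.
Variables (K : comNzRingType) (B : algType K) (a b c d : K).
Variables (A0 A : B -> Prop) (s sV t tV : B).
Hypotheses (sK : s * sV = 1) (sVK : sV * s = 1).
Hypotheses (tK : t * tV = 1) (tVK : tV * t = 1).
Hypotheses (abcd : a * b * c * d = 1) (s_cubic : cubic_elt a b c s = 0).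
Hypothesis braid : s * t * s = t * s * t.
Hypothesis bmw0 : bmw_elt b c t tV s sV = 0.
Hypotheses (A0alg : subalgebra A0) (Aalg : subalgebra A).
Hypothesis A0A : forall u, A0 u -> A u.
Hypotheses (At : A t) (AtV : A tV).
Hypothesis A_triple : forall u, A u -> triple A0 t tV u.
Hypothesis A0_comm : forall u, A0 u -> GRing.comm u s.

Local Notation U := (triple A s sV).
Local Notation g e := (if e : bool then sV else s).
Local Notation h e := (if e : bool then tV else t).

Let UD := @tripleD _ _ _ s sV Aalg.
Let UN := @tripleN _ _ _ s sV Aalg.
Let UZ := @tripleZ _ _ _ s sV Aalg.
Let Umull := @triple_mull _ _ _ s sV Aalg.
Let Umulr := @triple_mulr _ _ _ s sV Aalg.
Let Ugg := triple_letter2 Aalg sK sVK abcd s_cubic.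

Lemma triple_sandwich e f k : U (h e * g f * h k).
Proof. by apply: triple_gen => //; [case: e | case: k]. Qed.

Lemma triple_sVtsV : U (sV * t * sV).
Proof.
pose y := b * c; pose yV := a * d.
have yK : yV ^+ 2 * y ^+ 2 = 1.
  have yVy : yV * y = a * b * c * d by rewrite /y /yV; ring.
  by rewrite -exprMn yVy abcd expr1n.
rewrite -[X in U X]scale1r -yK -scalerA; apply: UZ.
have AU u : A u -> U u by apply: triple_base.
have -> : y ^+ 2 *: (sV * t * sV) = y *: (t * sV * t) + t * s * t
    + ((b + c) * y ^+ 2) *: sV ^+ 2 - (b + c) *: t ^+ 2
    - y ^+ 3 *: (sV * tV * sV).
  move: bmw0; rewrite /bmw_elt -/y (addrC (- _)) -!addrA => /eqP.
  by rewrite addr_eq0 !opprD !opprK => /eqP.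
rewrite (braidV sK sVK tK tVK braid).
apply: UD (UN (UZ _ (triple_sandwich true true true))).
apply: UD (UN (UZ _ (AU _ (subalgM Aalg At At)))).
apply: UD (UZ _ (Ugg true true)).
exact: UD (UZ _ (triple_sandwich false true false))
  (triple_sandwich false false false).
Qed.

Lemma triple_stVs : U (s * tV * s).
Proof.
have bV := braidV sK sVK tK tVK braid.
have slideV := braid_slide sVK tK bV.
rewrite [X in U (X * _ * _)](cubic_lin sK sVK s_cubic).
rewrite !mulrDl !mulNr -!scalerAl mul1r.
rewrite -(mulrA sV sV) -(mulrA sV (sV * tV)) slideV !mulrA.
apply: UD; last by apply/UZ/Umulr/triple_sVtsV.
apply: UD; last by apply/UN/UZ/(triple_sandwich false true true).
exact: UZ _ (Umull AtV (triple_letter s sV Aalg false)).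
Qed.

Lemma triple_gtg e k f : U (g e * h k * g f).
Proof.
have S := triple_sandwich; have bV := braidV sK sVK tK tVK braid.
case: e; case: k; case: f.
- by rewrite bV; apply: (S true true true).
- by rewrite (braid_slide sVK tK bV); apply: (S false true true).
- exact: triple_sVtsV.
- by rewrite -(braid_slide tK sVK (esym braid)); apply: (S false false true).
- by rewrite -(braid_slide tVK sK (esym bV)); apply: (S true true false).
- exact: triple_stVs.
- by rewrite (braid_slide sK tVK braid); apply: (S true false false).
- by rewrite braid; apply: (S false false false).
Qed.

Lemma triple_step e z : U z -> U (g e * z).
Proof.
have cg u k : A0 u -> GRing.comm u (g k).
  by case: k => A0u; [apply: (comm_inverse sK sVK)|]; apply: A0_comm.
apply: triple_stable => // {e z} e f u /A_triple.
move: u; apply: (triple_ind A0alg) => [u v|u A0u|k p q A0p A0q].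
- by rewrite mulrDr mulrDl; apply: UD.
- by rewrite -(cg u e A0u) -mulrA; apply: Umull (Ugg _ _); apply: A0A.
- rewrite !mulrA -(cg p e A0p) -(mulrA _ q) (cg q f A0q) mulrA.
  rewrite -2!(mulrA p).
  by apply: Umulr (Umull (A0A A0p) (triple_gtg _ _ _)); apply: A0A.
Qed.
End TripleStep.

Lemma fin_gen_family (K : nzRingType) (V : lmodType K) (J : finType)
    (v : J -> V) :
  (forall z, exists r : J -> K, z = \sum_j r j *: v j) -> fin_gen_module V.
Proof.
move=> vP; exists #|J|, (fun i => v (enum_val i)) => z.
have [r ->] := vP z; exists (fun i => r (enum_val i)).
by rewrite (reindex _ (onW_bij _ (@enum_val_bij J))).
Qed.

Section FiniteTriple.
Variables (K : comNzRingType) (B : algType K) (A : B -> Prop) (s sV : B).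
Variables (k : nat) (v : 'I_k -> B).
Hypothesis Aalg : subalgebra A.
Hypothesis Av : forall u, A u -> exists r : 'I_k -> K, u = \sum_i r i *: v i.
Local Notation g e := (if e : bool then sV else s).

Lemma triple_fin_gen : (forall z, triple A s sV z) -> fin_gen_module B.
Proof.
move=> AP; pose J := ('I_k + bool * 'I_k * 'I_k)%type.
pose w (j : J) : B := match j with
  | inl i => v i
  | inr (e, i, i') => v i * g e * v i'
  end.
pose S z := exists r : J -> K, z = \sum_j r j *: w j.
suff SP z : triple A s sV z -> S z.
  by apply: (@fin_gen_family _ _ _ w) => z; apply: SP.
have SD x y : S x -> S y -> S (x + y).
  move=> [r ->] [q ->]; exists (fun j => r j + q j).
  by rewrite -big_split; apply: eq_bigr => j _; rewrite scalerDl.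
have S0 : S 0.
  by exists (fun=> 0); rewrite big1 // => j _; rewrite scale0r.
have Sw c j : S (c *: w j).
  exists (fun i => if i == j then c else 0); rewrite (bigD1 j) //= eqxx.
  by rewrite big1 ?addr0 // => i /negPf->; rewrite scale0r.
apply: (triple_ind Aalg) => // {z} [u /Av[r ->]|e p q /Av[r ->] /Av[r' ->]].
  by apply: (big_ind S) => // i _; apply: (Sw _ (inl i)).
rewrite !mulr_suml; apply: (big_ind S) => // i _.
rewrite mulr_sumr; apply: (big_ind S) => // i' _.
by rewrite -!scalerAl -scalerAr scalerA; apply: (Sw _ (inr (e, i, i'))).
Qed.
End FiniteTriple.

Section BMWgenerators.
Variable n : nat.
Implicit Types i j : 'I_n.-1.

Definition BMWword (u : word 'I_n.-1) : BMW n :=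
  H_to_BMW n (RB_to_H n (gelt _ (pword (@braid_rel n) u))).

Lemma BMWword_nil : BMWword [::] = 1.
Proof. by rewrite -[LHS]/(H_to_BMW n (RB_to_H n 1)) !rmorph1. Qed.

Lemma BMWword_cat u v : BMWword (u ++ v) = BMWword u * BMWword v.
Proof. by rewrite /BMWword -pwordM -geltM !rmorphM. Qed.

Lemma BMWword_cong u v : word_cong (@braid_rel n) u v -> BMWword u = BMWword v.
Proof. by move=> /pword_eq uv; rewrite /BMWword uv. Qed.

Lemma BMWword_gen i : BMWword [:: (i, false)] = BMWs i.
Proof. by []. Qed.

Lemma BMWword_genV i : BMWword [:: (i, true)] = BMWsV i.
Proof. by rewrite /BMWsV /HsV /artin /pgen pwordV. Qed.

Lemma BMWsK i : BMWs i * BMWsV i = 1.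
Proof.
rewrite -BMWword_gen -BMWword_genV -BMWword_cat -BMWword_nil.
exact/BMWword_cong/(wc_inv _ (i, false)).
Qed.

Lemma BMWsVK i : BMWsV i * BMWs i = 1.
Proof.
rewrite -BMWword_gen -BMWword_genV -BMWword_cat -BMWword_nil.
exact/BMWword_cong/(wc_inv _ (i, true)).
Qed.

Lemma BMWs_cubic i : cubic_elt Base.a Base.b Base.c (BMWs i) = 0.
Proof.
rewrite /BMWs /Hs -!rmorph_cubic.
suff -> : RB_to_H n (cubic_elt Base.a Base.b Base.c (RBgen i)) = 0.
  by rewrite rmorph0.
by apply: apr_eq0; exists i.
Qed.

Lemma BMWs_relator i j : j = i.+1 :> nat ->
  bmw_elt Base.b Base.c (BMWs i) (BMWsV i) (BMWs j) (BMWsV j) = 0.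
Proof. by move=> ij; rewrite -rmorph_bmw; apply: apr_eq0; exists i, j. Qed.

Lemma BMWs_braid i j : j = i.+1 :> nat ->
  BMWs j * BMWs i * BMWs j = BMWs i * BMWs j * BMWs i.
Proof.
move=> ij; rewrite -!BMWword_gen -!BMWword_cat.
exact/esym/BMWword_cong/wc_rel/braid_adj.
Qed.

Lemma BMWs_far i j : (i.+1 < j)%N -> GRing.comm (BMWs i) (BMWs j).
Proof.
move=> ij; rewrite /GRing.comm -!BMWword_gen -!BMWword_cat.
exact/BMWword_cong/wc_rel/braid_far.
Qed.

Lemma BMW_ind (P : BMW n -> Prop) :
  P 1 -> (forall u v, P u -> P v -> P (u + v)) ->
  (forall k u, P u -> P (k *: u)) ->
  (forall i u, P u -> P (BMWs i * u)) ->
  (forall i u, P u -> P (BMWsV i * u)) -> forall z, P z.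
Proof.
move=> P1 PD PZ Ps PsV z.
have [h ->] := apr_surj z; have [x ->] := apr_surj h.
rewrite -/(RB_to_H n x) -/(H_to_BMW n _).
rewrite [x]gelt_span (raddf_sum (RB_to_H n)) (raddf_sum (H_to_BMW n)).
apply: (big_ind P) => //.
  by rewrite -(scale0r 1); apply: PZ.
move=> y _ /=; rewrite (linearZ_LR (RB_to_H n)) (linearZ_LR (H_to_BMW n)) /=.
apply: PZ.
have [u ->] := pwordP y; rewrite -/(BMWword u).
elim: u => [|[i e] u IH]; first by rewrite BMWword_nil.
rewrite -cat1s BMWword_cat; case: e; last exact: Ps.
by rewrite BMWword_genV; apply: PsV.
Qed.
End BMWgenerators.

Lemma image_subalgebra (K : comNzRingType) (B C : algType K)
    (f : {lrmorphism B -> C}) : subalgebra (image_of f).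
Proof.
split; first by exists 1; rewrite rmorph1.
- by move=> _ _ [x <-] [y <-]; exists (x + y); rewrite rmorphD.
- by move=> _ _ [x <-] [y <-]; exists (x * y); rewrite rmorphM.
- by move=> k _ [x <-]; exists (k *: x); rewrite linearZ.
Qed.

Lemma triple_morph (K : comNzRingType) (B C : algType K)
    (f : {lrmorphism B -> C}) (A : B -> Prop) (A' : C -> Prop) (s sV z : B) :
  subalgebra A -> subalgebra A' -> (forall u, A u -> A' (f u)) ->
  triple A s sV z -> triple A' (f s) (f sV) (f z).
Proof.
move=> Aalg A'alg fA; move: z.
apply: (triple_ind Aalg) => [u v|u Au|e p q Ap Aq].
- by rewrite rmorphD; apply: tripleD.
- by apply/triple_base/fA.
- have gen := triple_gen (f s) (f sV) A'alg.
  by case: e; rewrite !rmorphM; [apply: (gen true) | apply: (gen false)];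
    apply: fA.
Qed.

Lemma BMW_inc_sV n i : BMW_inc n (BMWsV i) = BMWsV (widen_gen i).
Proof. by rewrite /BMWsV BMW_incE H_inc_sV. Qed.

Lemma ord_maxVwiden n (i : 'I_n.+2.-1) :
  i = ord_max \/ exists j : 'I_n.+1.-1, i = widen_gen j.
Proof.
have [lt_in|le_ni] := ltnP i n.
  by right; exists (Ordinal lt_in); apply: val_inj.
by left; apply/val_inj/eqP; rewrite eqn_leq le_ni -ltnS ltn_ord.
Qed.

Lemma BMW1_scalar (z : BMW 1) : exists k, z = k%:A.
Proof.
elim/BMW_ind: z => [|_ _ [k ->] [l ->]|k _ [l ->]|[]|[]] //.
- by exists 1; rewrite scale1r.
- by exists (k + l); rewrite scalerDl.
- by exists (k * l); rewrite scalerA.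
Qed.

Lemma BMW_comm n (C : algType Base.R) (f : {lrmorphism BMW n -> C}) (x : C) :
  (forall i, GRing.comm x (f (BMWs i))) -> forall z, GRing.comm x (f z).
Proof.
move=> xs z; elim/BMW_ind: z => [|u v Cu Cv|k u Cu|i u Cu|i u Cu].
- by rewrite rmorph1; apply: commr1.
- by rewrite rmorphD; apply: commrD.
- by rewrite (linearZ_LR f) /GRing.comm -scalerAr -scalerAl; congr (_ *: _).
- by rewrite rmorphM; apply: commrM Cu; apply: xs.
- rewrite rmorphM; apply: commrM Cu; apply: comm_inverse (xs i).
    by rewrite -rmorphM BMWsK rmorph1.
  by rewrite -rmorphM BMWsVK rmorph1.
Qed.

Lemma BMW_inc_far n (z : BMW n.+1) :
  GRing.comm (BMW_inc n.+2 (BMW_inc n.+1 z)) (@BMWs n.+3 ord_max).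
Proof.
apply/commr_sym.
apply: (BMW_comm (f := BMW_inc n.+2 \o BMW_inc n.+1)) => i.
rewrite -[X in GRing.comm _ X]/(BMW_inc n.+2 (BMW_inc n.+1 (BMWs i))).
rewrite !BMW_inc_s.
by apply/commr_sym/BMWs_far; rewrite /= ltnS.
Qed.

Section TripleBMW.
Variable n : nat.
Let s := @BMWs n.+2 ord_max.
Let sV := @BMWsV n.+2 ord_max.
Local Notation A := (image_of (BMW_inc n.+1)).

Lemma triple_all :
  (forall (e : bool) z, triple A s sV z ->
     triple A s sV ((if e then sV else s) * z)) ->
  forall z, triple A s sV z.
Proof.
have Aalg : subalgebra A := image_subalgebra (BMW_inc n.+1).
move=> step; apply: BMW_ind => [|u v|k u|i u Uu|i u Uu].
- by apply: triple_base; apply: subalg1.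
- exact: tripleD.
- exact: tripleZ.
- have [->|[j ->]] := ord_maxVwiden i; first exact: (step false).
  by apply: triple_mull => //; exists (BMWs j); rewrite BMW_inc_s.
- have [->|[j ->]] := ord_maxVwiden i; first exact: (step true).
  by apply: triple_mull => //; exists (BMWsV j); rewrite BMW_inc_sV.
Qed.
End TripleBMW.

Lemma BMW_triple n (z : BMW n.+2) :
  triple (image_of (BMW_inc n.+1)) (@BMWs n.+2 ord_max) (@BMWsV n.+2 ord_max) z.
Proof.
elim: n z => [|n IH]; apply: triple_all => e z.
  apply: triple_stable => [|{}e f _ [u <-]]; first exact: image_subalgebra.
  have [k ->] := BMW1_scalar u.
  rewrite lrmorph_alg mulr_algr -scalerAl; apply: tripleZ.
    exact: image_subalgebra.
  exact: (triple_letter2 (image_subalgebra _) (BMWsK _) (BMWsVK _) Base.abcV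
    (BMWs_cubic _)).
pose A0 := image_of (BMW_inc n.+2 \o BMW_inc n.+1).
pose m : 'I_n.+3.-1 := widen_gen (ord_max : 'I_n.+2.-1).
apply: (@triple_step _ _ Base.a Base.b Base.c Base.abc_inv A0 _ _ _
  (BMWs m) (BMWsV m)).
- exact: BMWsK.
- exact: BMWsVK.
- exact: BMWsK.
- exact: BMWsVK.
- exact: Base.abcV.
- exact: BMWs_cubic.
- exact: BMWs_braid.
- exact: BMWs_relator.
- exact: (image_subalgebra (BMW_inc n.+2 \o BMW_inc n.+1)).
- exact: image_subalgebra.
- by move=> _ [u <-]; exists (BMW_inc n.+1 u).
- by exists (@BMWs n.+2 ord_max); rewrite BMW_inc_s.
- by exists (@BMWsV n.+2 ord_max); rewrite BMW_inc_sV.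
- move=> _ [u <-]; rewrite -BMW_inc_s -BMW_inc_sV.
  apply: (triple_morph _ _ _ (IH u)).
  + exact: image_subalgebra.
  + exact: (image_subalgebra (BMW_inc n.+2 \o BMW_inc n.+1)).
  + by move=> _ [w <-]; exists w.
- by move=> _ [u <-]; apply: BMW_inc_far.
Qed.

Lemma BMW_fin_gen n : fin_gen_module (BMW n.+1).
Proof.
elim: n => [|n [k [v vP]]].
  exists 1, (fun=> 1) => z; have [c ->] := BMW1_scalar z.
  by exists (fun=> c); rewrite big_ord1.
apply: (triple_fin_gen (image_subalgebra (BMW_inc n.+1)) _ (@BMW_triple n)).
move=> _ [u <-]; have [r ->] := vP u; exists r.
rewrite (raddf_sum (BMW_inc n.+1)); apply: eq_bigr => i _.
exact: (linearZ_LR (BMW_inc n.+1)).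
Qed.

Lemma Hecke_relator n u : bmw_relator u -> H_to_Hecke n u = 0.
Proof.
case=> i [j [_ ->]]; rewrite rmorph_bmw.
have quad (k : 'I_n.-1) :
    quadratic_elt Base.b Base.c (H_to_Hecke n (Hs k)) = 0.
  rewrite H_to_Hecke_s -rmorph_quadratic.
  by apply: apr_eq0; exists k.
have inv (k : 'I_n.-1) : H_to_Hecke n (Hs k) * H_to_Hecke n (HsV k) = 1.
  by rewrite -rmorphM -(rmorphM (RB_to_H n)) geltM mulgV gelt1 !rmorph1.
exact: bmw_elt_quadratic.
Qed.

Theorem proposition4p2 :
  (forall n : nat, (0 < n)%N ->
     (forall z : Hecke n, exists h : H n, H_to_Hecke n h = z) /\
     exists f : {lrmorphism BMW n -> Hecke n},
       forall h : H n, H_to_Hecke n h = f (H_to_BMW n h)) /\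
  (* With [m := n.+1 >= 1]: [A] is the image of [BMW m] in [BMW m.+1], and
     [ord_max : 'I_m] is the index of the last Artin generator [s_m]. *)
  (forall (n : nat) (z : BMW n.+2),
     let A := image_of (BMW_inc n.+1) in
     exists u v w : BMW n.+2,
       [/\ A u, bispan A (@BMWs n.+2 ord_max) v,
           bispan A (@BMWsV n.+2 ord_max) w & z = u + v + w]) /\
  (forall n : nat, (0 < n)%N -> fin_gen_module (BMW n)).
Proof.
split=> [n _|]; last first.
  by split=> [n z|[|n] // _]; [apply: BMW_triple | apply: BMW_fin_gen].
split=> [z|].
  have [x ->] := apr_surj z; exists (RB_to_H n x); exact: H_to_HeckeE.
exists (alift (@bmw_proper n) (@Hecke_relator n)) => h.
exact/esym/(aliftE (@bmw_proper n) (@Hecke_relator n)).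
Qed.
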